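(* Let $n\ge2$ be an integer. Let $\Gamma$ be an unoriented planar $4$-valent graph having a vertex $v$ with a loop edge at $v$ that joins two cyclically adjacent ends of $v$ and bounds an empty disk, and let $\Gamma'$ be the graph obtained from $\Gamma$ by deleting $v$ and the loop edge and joining the remaining two ends at $v$ by an arc. Then $$\langle\!\langle\Gamma\rangle\!\rangle=([2n-2]+[2])\,\langle\!\langle\Gamma'\rangle\!\rangle .$$
   Context: Throughout, $n\ge 2$ is an integer, $q$ is a formal variable, and $[m]=\frac{q^m-q^{-m}}{q-q^{-1}}$ for $m\in\mathbb Z$. Graphs. A planar $4$-valent graph is embedded in $\mathbb R^2$, considered up to planar isotopy; it may have loops, multiple edges, several components, and components that are circles without vertices. An orientation of all edges (and circles) is balanced if every vertex has two incoming and two outgoing edge-ends. A vertex is then crossing-type if in cyclic order the ends are in, in, out, out, and alternating if they are in, out, in, out. Local relations relate graphs that are identical outside a disk. MOY graph polynomial. For oriented planar $4$-valent graphs $\Gamma$ all of whose vertices are crossing-type, $R(\Gamma)\in\mathbb Z[q,q^{-1}]$ is the (well-defined, unique) planar-isotopy-invariant function with $R(\emptyset)=1$ and satisfying the following local relations. (i) A circle without vertices bounding an empty disk may be removed with factor $[n]$. (ii) A vertex having a loop edge that bounds an empty disk may be replaced by an arc with factor $[n-1]$. (iii) An empty bigon face whose two edges are both directed from one vertex to the other equals $[2]$ times the graph with the bigon collapsed to a single vertex. (iv) An empty bigon face with vertices $v,w$ and edges $v\to w$, $w\to v$ equals $G_1+[n-2]G_2$, where in $G_2$ the bigon is replaced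 by two arcs, one joining the two outer ends at $v$ and one joining the two outer ends at $w$, and in $G_1$ by the other two disjoint orientation-compatible arcs (each joining an outer end at $v$ to an outer end at $w$). (v) For three parallel, equally oriented strands, let $E_i$ ($i=1,2$) denote a vertex merging strands $i,i+1$; then $E_1E_2E_1+E_2=E_2E_1E_2+E_1$ (composition by stacking). (vi) Let the disk have six boundary points $p_1,\dots,p_6$ in cyclic order, alternately incoming and outgoing. Let $T$ be the triangle graph with directed-cycle triangular face whose three vertices carry outer ends $\{p_1,p_2\},\{p_3,p_4\},\{p_5,p_6\}$, and $T'$ the analogous one with $\{p_2,p_3\},\{p_4,p_5\},\{p_6,p_1\}$. Let $M$ be three disjoint arcs joining $p_1p_2,p_3p_4,p_5p_6$ and $M'$ three disjoint arcs joining $p_2p_3,p_4p_5,p_6p_1$. Then $T+[n-3]M'=T'+[n-3]M$. Bracket. For such $\Gamma$, $[\Gamma]=(q^{1-n})^{\mathrm{rot}(\Gamma)}R(\Gamma)$, where $\mathrm{rot}(\Gamma)$ is the sum over the disjoint oriented circles obtained by splicing each vertex according to orientation (into two non-crossing arcs, each from an incoming to an adjacent outgoing end) of $+1$ for each counterclockwise and $-1$ for each clockwise circle. For a balanced oriented graph with alternating vertices, $[\,\cdot\,]$ is extended by expanding each alternating vertex as $q$ times the smoothing in which each incoming strand turns left, plus $q^{-1}$ times the smoothing in which each incoming strand turns right. Evaluation of unoriented graphs. For an unoriented planar $4$-valent graph $\Gamma$, $\langle\!\langle\Gamma\rangle\!\rangle=\sum_{o}[\Gamma^{o}]$, the sum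 over all balanced orientations $o$ of $\Gamma$. *)

(* Defs.v *)
From HB Require Import structures.
From mathcomp Require Import all_boot all_order all_algebra.

Set Implicit Arguments.
Unset Strict Implicit.
Unset Printing Implicit Defensive.

Import Order.TTheory GRing.Theory Num.Theory.

Local Open Scope ring_scope.

(* The coefficients Z[q, q^-1] are viewed inside the field Q(q). *)
Definition LF := {fraction {poly int}}.

Definition q : LF := FracField.tofrac ('X : {poly int}).

Definition qint (m : int) : LF := (q ^ m - q ^ (- m)) / (q - q^-1).

Definition is_laurent (x : LF) : Prop :=
  exists (p : {poly int}) (k : nat), x = FracField.tofrac p / q ^+ k.

(** * Planar 4-valent graphs up to planar isotopy

   A graph embedded in the plane is put in general position with respect to
   the height function, each vertex having two ends going down and two ends
   going up.  Read from bottom to top it is a word of slices (x, i): a local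
   minimum (Cup), a local maximum (Cap) or a vertex (Vert), with exactly i
   strands passing to its left.  A circle without vertices is a closed curve
   made of cups and caps only. *)

Inductive piece := Cup | Cap | Vert.

Definition arity_in (x : piece) : nat :=
  match x with Cup => 0 | Cap => 2 | Vert => 2 end.

Definition arity_out (x : piece) : nat :=
  match x with Cup => 2 | Cap => 0 | Vert => 2 end.

Definition slice : Type := piece * nat.
Definition word : Type := seq slice.

(* [width m w] is the number of strands above [w] when there are [m] strands
   below it; [None] if some slice of [w] does not fit. *)
Fixpoint width (m : nat) (w : word) : option nat :=
  if w is (x, i) :: w' then
    if (i + arity_in x <= m)%N then width (m - arity_in x + arity_out x)%N w'
    else None
  else Some m.

Definition is_graph (G : word) : bool := width 0 G == Some 0%N.

(* Elementary isotopies: two far apart pieces exchange heights (y is to the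
   right of x, with k strands between them); a zigzag is straightened; a vertex
   is rotated by a quarter of a turn (in either direction), the end that ceases
   to be an upper, resp. a lower, one being bent around. *)
Inductive move : word -> word -> Prop :=
| Exchange (x y : piece) (i k : nat) :
    move [:: (y, i + arity_in x + k)%N; (x, i)]
         [:: (x, i); (y, i + arity_out x + k)%N]
| ZigzagL (i : nat) : move [:: (Cup, i.+1); (Cap, i)] [::]
| ZigzagR (i : nat) : move [:: (Cup, i); (Cap, i.+1)] [::]
| TurnL (i : nat) : move [:: (Cup, i); (Vert, i.+1); (Cap, i.+2)] [:: (Vert, i)]
| TurnR (i : nat) : move [:: (Cup, i.+2); (Vert, i.+1); (Cap, i)] [:: (Vert, i)].

Inductive isotopic : word -> word -> Prop :=
| iso_move (U u v W : word) :
    move u v -> is_graph (U ++ u ++ W) -> is_graph (U ++ v ++ W) ->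
    isotopic (U ++ u ++ W) (U ++ v ++ W)
| iso_refl (G : word) : isotopic G G
| iso_sym (G H : word) : isotopic G H -> isotopic H G
| iso_trans (G H K : word) : isotopic G H -> isotopic H K -> isotopic G K.

(** * Balanced orientations

   At each height a strand is oriented upwards (true) or downwards (false).
   The arguments of a constructor are the orientations of its ends: [OCup b]
   and [OCap b] have left end b and right end ~~ b; [OVert a b c d] has
   lower-left a, lower-right b, upper-left c and upper-right d.  The counter-
   clockwise cyclic order of the ends of a vertex is a, b, d, c; a lower end is
   incoming iff it is true, an upper end is incoming iff it is false. *)

Inductive opiece :=
| OCup of bool
| OCap of bool
| OVert of bool & bool & bool & bool.

Definition legs_in (x : opiece) : seq bool :=
  match x with
  | OCup _ => [::]
  | OCap b => [:: b; ~~ b]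
  | OVert a b _ _ => [:: a; b]
  end.

Definition legs_out (x : opiece) : seq bool :=
  match x with
  | OCup b => [:: b; ~~ b]
  | OCap _ => [::]
  | OVert _ _ c d => [:: c; d]
  end.

Definition balanced (x : opiece) : bool :=
  if x is OVert a b c d then (a + b + ~~ c + ~~ d == 2)%N else true.

(* The pairs of opposite ends are a, d and b, c; the vertex is alternating iff
   the members of each pair are both incoming or both outgoing. *)
Definition alternating (x : opiece) : bool :=
  if x is OVert a b c d then
    [&& balanced x, a == ~~ d & b == ~~ c]
  else false.

Definition oslice : Type := opiece * nat.
Definition oword : Type := seq oslice.

(* Orientations of the strands above [w], given those of the strands below. *)
Fixpoint run (s : seq bool) (w : oword) : option (seq bool) :=
  if w is (x, i) :: w' then
    if [&& (i <= size s)%N,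
           take (size (legs_in x)) (drop i s) == legs_in x & balanced x]
    then run (take i s ++ legs_out x ++ drop (i + size (legs_in x)) s) w'
    else None
  else Some s.

Definition is_ograph (G : oword) : bool := run [::] G == Some [::].

Definition is_crossing_graph (G : oword) : bool :=
  is_ograph G && all (fun s => ~~ alternating s.1) G.

Definition shape (s : oslice) : slice :=
  (match s.1 with OCup _ => Cup | OCap _ => Cap | OVert _ _ _ _ => Vert end,
   s.2).

(* An isotopy carries the orientation along.  In an elementary isotopy this is
   automatic: the pieces outside the disk keep their labels, and these
   determine the labels inside. *)
Definition omove (u v : oword) : Prop := move (map shape u) (map shape v).

Definition bools : seq bool := [:: true; false].

Definition labellings1 (s : slice) : seq oslice :=
  [seq (x, s.2) | x <-
    match s.1 with
    | Cup => [seq OCup b | b <- bools]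
    | Cap => [seq OCap b | b <- bools]
    | Vert => [seq OVert ab.1 ab.2 cd.1 cd.2 |
                 ab <- [seq (a, b) | a <- bools, b <- bools],
                 cd <- [seq (c, d) | c <- bools, d <- bools]]
    end].

Fixpoint labellings (G : word) : seq oword :=
  if G is s :: G' then
    [seq t :: o | t <- labellings1 s, o <- labellings G']
  else [:: [::]].

Definition balanced_orientations (G : word) : seq oword :=
  [seq o <- labellings G | is_ograph o].

(** * The MOY graph polynomial *)

(* A local relation: the sums of the two sides, placed in any exterior. *)
Definition local_relation (R : oword -> LF) (lhs rhs : seq (LF * oword)) : Prop :=
  forall U W : oword,
    all (fun t => is_crossing_graph (U ++ t.2 ++ W)) (lhs ++ rhs) ->
    \sum_(t <- lhs) t.1 * R (U ++ t.2 ++ W) =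
    \sum_(t <- rhs) t.1 * R (U ++ t.2 ++ W).

(* Only the values of [R] on crossing-type graphs matter.  Each relation is
   stated for one position of its disk (the others are isotopic), with b ranging
   over the two global orientations. *)
Record is_MOY (n : nat) (R : oword -> LF) : Prop := {
  MOY_laurent : forall G : oword, is_crossing_graph G -> is_laurent (R G);
  MOY_isotopy : forall U u v W : oword, omove u v ->
    is_crossing_graph (U ++ u ++ W) -> is_crossing_graph (U ++ v ++ W) ->
    R (U ++ u ++ W) = R (U ++ v ++ W);
  MOY_empty : R [::] = 1;
  MOY_circle : forall (b : bool) (i : nat), local_relation R
    [:: (1, [:: (OCup b, i); (OCap b, i)])]
    [:: (qint n%:Z, [::])];
  (* the loop lies to the right, resp. to the left, of the vertex *)
  MOY_loop_right : forall (b : bool) (i : nat), local_relation R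
    [:: (1, [:: (OCup b, i.+1); (OVert b b b b, i); (OCap b, i.+1)])]
    [:: (qint (n%:Z - 1), [::])];
  MOY_loop_left : forall (b : bool) (i : nat), local_relation R
    [:: (1, [:: (OCup (~~ b), i); (OVert b b b b, i.+1); (OCap (~~ b), i)])]
    [:: (qint (n%:Z - 1), [::])];
  MOY_parallel_bigon : forall (b : bool) (i : nat), local_relation R
    [:: (1, [:: (OVert b b b b, i); (OVert b b b b, i)])]
    [:: (qint 2, [:: (OVert b b b b, i)])];
  MOY_antiparallel_bigon : forall (b : bool) (i : nat), local_relation R
    [:: (1, [:: (OVert (~~ b) b b (~~ b), i); (OVert b (~~ b) (~~ b) b, i)])]
    [:: (1, [::]);
        (qint (n%:Z - 2), [:: (OCap (~~ b), i); (OCup (~~ b), i)])];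
  MOY_three_strands : forall (b : bool) (i : nat),
    let E1 := (OVert b b b b, i) in
    let E2 := (OVert b b b b, i.+1) in
    local_relation R
    [:: (1, [:: E1; E2; E1]); (1, [:: E2])]
    [:: (1, [:: E2; E1; E2]); (1, [:: E1])];
  (* Lower boundary points p1, p2, p3 from left to right, upper ones p4, p5, p6
     from right to left. *)
  MOY_triangle : forall (b : bool) (i : nat),
    let T := [:: (OVert b (~~ b) (~~ b) b, i); (OVert b b b b, i.+1);
                 (OVert (~~ b) b b (~~ b), i)] in
    let T' := [:: (OVert (~~ b) b b (~~ b), i.+1); (OVert b b b b, i);
                  (OVert b (~~ b) (~~ b) b, i.+1)] in
    let M := [:: (OCap b, i); (OCup b, i)] in
    let M' := [:: (OCap (~~ b), i.+1); (OCup (~~ b), i.+1)] in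
    local_relation R
    [:: (1, T); (qint (n%:Z - 3), M')]
    [:: (1, T'); (qint (n%:Z - 3), M)]
}.

(** * Rotation number and bracket *)

(* The two ways of smoothing a vertex with given orientations of its ends: two
   vertical arcs, or a local maximum below a local minimum. *)
Definition smooth_vertical : oword := [::].
Definition smooth_horizontal (a c : bool) (i : nat) : oword :=
  [:: (OCap a, i); (OCup c, i)].

(* An incoming end is joined to an adjacent outgoing one.  At a crossing-type
   vertex whose lower ends are both incoming or both outgoing this is done by
   the vertical arcs, otherwise the two lower ends are joined. *)
Definition splice1 (s : oslice) : oword :=
  if s is (OVert a b c d, i) then
    if a == b then smooth_vertical else smooth_horizontal a c i
  else [:: s].

Definition splice (G : oword) : oword := flatten (map splice1 G).

(* Sum over the circles of a graph without vertices of +1 for each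
   counterclockwise one and -1 for each clockwise one.  Scanning upwards,
   [comp] lists from left to right the names of the connected components (of
   the part already scanned) to which the strands belong, [k] being the next
   fresh name.  A cap that joins two strands of the same component is the
   highest point of a circle, which is clockwise iff the curve runs there from
   left to right. *)
Fixpoint circles_sum (comp : seq nat) (k : nat) (G : oword) : int :=
  match G with
  | [::] => 0
  | (OCup _, i) :: G' =>
      circles_sum (take i comp ++ [:: k; k] ++ drop i comp) k.+1 G'
  | (OCap b, i) :: G' =>
      let x := nth 0%N comp i in
      let y := nth 0%N comp i.+1 in
      let rest := take i comp ++ drop i.+2 comp in
      if x == y then (if b then -1 else 1) + circles_sum rest k G'
      else circles_sum [seq if z == y then x else z | z <- rest] k G'
  | (OVert _ _ _ _, _) :: G' => circles_sum comp k G'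
  end.

Definition rotation_number (G : oword) : int := circles_sum [::] 0 (splice G).

Definition bracket_crossing (n : nat) (R : oword -> LF) (G : oword) : LF :=
  (q ^ (1 - n%:Z)) ^ rotation_number G * R G.

(* At an alternating vertex the incoming ends are a, d if a = true and b, c
   otherwise.  A strand entering by a and turning left leaves by c; one entering
   by b and turning left leaves by a. *)
Definition smooth_left (a c : bool) (i : nat) : oword :=
  if a then smooth_vertical else smooth_horizontal a c i.
Definition smooth_right (a c : bool) (i : nat) : oword :=
  if a then smooth_horizontal a c i else smooth_vertical.

(* Expansion of all the alternating vertices, as a formal linear combination of
   crossing-type graphs. *)
Fixpoint expand (G : oword) : seq (LF * oword) :=
  match G with
  | [::] => [:: (1, [::])]
  | s :: G' =>
      let E := expand G' in
      match s with
      | (OVert a b c d, i) =>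
          if alternating (OVert a b c d) then
            [seq (q * t.1, smooth_left a c i ++ t.2) | t <- E] ++
            [seq (q^-1 * t.1, smooth_right a c i ++ t.2) | t <- E]
          else [seq (t.1, s :: t.2) | t <- E]
      | _ => [seq (t.1, s :: t.2) | t <- E]
      end
  end.

Definition bracket (n : nat) (R : oword -> LF) (G : oword) : LF :=
  \sum_(t <- expand G) t.1 * bracket_crossing n R t.2.

Definition evaluation (n : nat) (R : oword -> LF) (G : word) : LF :=
  \sum_(o <- balanced_orientations G) bracket n R o.

(** * Removal of a loop *)

(* [loop_removal G G']: up to isotopy, G has a vertex whose two right-hand ends
   are joined by a loop bounding an empty disk, and in G' the vertex with its
   loop is replaced by a vertical arc.  Any disk in the plane that contains just
   a vertex with an empty loop can be brought to this position. *)
Definition loop_removal (G G' : word) : Prop :=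
  exists (U W : word) (i : nat),
    let H := U ++ [:: (Cup, i.+1); (Vert, i); (Cap, i.+1)] ++ W in
    let H' := U ++ W in
    [/\ is_graph H, is_graph H', isotopic G H & isotopic G' H'].

(* Main.v *)
Require Import Defs.
From mathcomp Require Import all_boot all_order all_algebra.
From mathcomp Require Import ring zify.

(** A vertex with an empty loop sits in a small disk that meets the rest of the
    graph in one strand. Fix an orientation of everything outside and let the
    strand go through the disk in a given direction. There are two ways to
    orient the loop. If the vertex is crossing-type, the loop relation removes it
    with factor [n-1], and the splice at the vertex cuts off a circle, which
    shifts the rotation number by one and so contributes q^(1-n) or q^(n-1). If
    the vertex is alternating, one smoothing splits off an empty circle, worth
    [n] times the opposite power of q, and the other one is just the strand.
    Altogether the factor is, for one direction of the strand,

      q^(n-1) [n-1] + q q^(1-n) [n] + q^-1  =  [2n-2] + [2],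

    and for the other direction the same with q and q^-1 exchanged
    ([loop_coefficient]). The factor depends neither on the direction nor on the
    exterior, so it comes out of the sum over all balanced orientations
    ([local_sum_loop], [evaluation_local]).

    The loop occurs in standard position only up to isotopy, so it remains to
    see that the evaluation is an isotopy invariant ([evaluation_isotopic]).
    The polynomial R is invariant by hypothesis. For the rotation number, which
    is defined by following circles, the point is that it is half the total
    turning, the sum of the signs of all cups and caps
    ([rotation_number_turning]). This follows by scanning the graph upwards: the
    arcs scanned so far do not cross, and the turning of an arc is determined by
    the direction of its left end. The total turning is visibly preserved by
    exchanges of heights and zigzags, and by quarter turns of crossing-type
    vertices. At an alternating vertex one compares smoothing by smoothing; a
    quarter turn permutes the two smoothings together with their
    coefficients. *)

Set Implicit Arguments.
Unset Strict Implicit.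
Unset Printing Implicit Defensive.

Import Order.TTheory GRing.Theory Num.Theory.

Local Open Scope ring_scope.

(** * Orientations transported upwards *)

Definition shift (T : Type) (i : nat) (w : seq (T * nat)) : seq (T * nat) :=
  [seq (x.1, i + x.2)%N | x <- w].

Lemma shift_cons (T : Type) i (x : T) j w :
  shift i ((x, j) :: w) = (x, i + j)%N :: shift i w.
Proof. by []. Qed.

Lemma run_cat s A B : run s (A ++ B) = obind (run^~ B) (run s A).
Proof.
elim: A s => [//|[x i] A IH] s /=.
by case: ifP => // _; rewrite IH.
Qed.

Lemma run_shift s1 s w :
  run (s1 ++ s) (shift (size s1) w) = omap (cat s1) (run s w).
Proof.
elim: w s => [//|[x i] w IH] s /=.
rewrite size_cat leq_add2l.
have dropE j : drop (size s1 + j) (s1 ++ s) = drop j s.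
  by rewrite addnC -drop_drop drop_size_cat.
have takeE j : take (size s1 + j) (s1 ++ s) = s1 ++ take j s.
  by rewrite takeD take_size_cat // drop_size_cat.
rewrite dropE -addnA dropE takeE; case: ifP => // _.
by rewrite -catA IH.
Qed.

Lemma run_step s1 c d x i w :
    size s1 = i -> size c = size (legs_in x) ->
  run (s1 ++ c ++ d) ((x, i) :: w) =
  if (c == legs_in x) && balanced x then run (s1 ++ legs_out x ++ d) w
  else None.
Proof.
move=> <- sc /=.
rewrite size_cat leq_addr drop_size_cat // take_size_cat // take_size_cat //.
by rewrite addnC -drop_drop drop_size_cat // -sc drop_size_cat.
Qed.

Lemma run_split s x i w s' :
    run s ((x, i) :: w) = Some s' ->
  exists s1 s2, [/\ s = s1 ++ legs_in x ++ s2, size s1 = i, balanced x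
                  & run (s1 ++ legs_out x ++ s2) w = Some s'].
Proof.
move=> /=; case: ifP => // /and3P[le_is /eqP legsE bal] runE.
exists (take i s), (drop (i + size (legs_in x)) s); split => //.
  by rewrite -[LHS](cat_take_drop i)
    -[drop i s in LHS](cat_take_drop (size (legs_in x))) legsE drop_drop addnC.
by rewrite size_takel.
Qed.

Arguments run : simpl never.

Lemma run_step_legs s1 s2 x i w : size s1 = i -> balanced x ->
  run (s1 ++ legs_in x ++ s2) ((x, i) :: w) = run (s1 ++ legs_out x ++ s2) w.
Proof. by move=> s1i bx; rewrite run_step // eqxx bx. Qed.

Lemma run_nil s : run s [::] = Some s. Proof. by []. Qed.

Lemma run_cup s1 s2 b i w : size s1 = i ->
  run (s1 ++ s2) ((OCup b, i) :: w) = run (s1 ++ [:: b, ~~ b & s2]) w.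
Proof. by move=> s1i; have := @run_step_legs s1 s2 (OCup b) i w s1i isT. Qed.

Lemma run_cap s1 s2 b i w : size s1 = i ->
  run (s1 ++ [:: b, ~~ b & s2]) ((OCap b, i) :: w) = run (s1 ++ s2) w.
Proof. by move=> s1i; have := @run_step_legs s1 s2 (OCap b) i w s1i isT. Qed.

Definition crossing (w : oword) : bool := all (fun s => ~~ alternating s.1) w.

Definition transports (s s' : seq bool) (w : oword) : bool :=
  (run s w == Some s') && crossing w.

Lemma transports_cat s s' s'' A B :
  transports s s' A -> transports s' s'' B -> transports s s'' (A ++ B).
Proof.
case/andP => /eqP runA crA /andP[/eqP runB crB].
by rewrite /transports run_cat runA /= runB eqxx /crossing all_cat; apply/and3P.
Qed.

Lemma transports_split s s'' A B :
    transports s s'' (A ++ B) ->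
  exists s', transports s s' A /\ transports s' s'' B.
Proof.
case/andP; rewrite run_cat /crossing all_cat => runAB /andP[crA crB].
case runA: (run s A) runAB => [s'|//] runB; exists s'.
by rewrite /transports runA eqxx; split; [ | apply/andP].
Qed.

Lemma transports_shift s1 s s' w :
  transports s s' w -> transports (s1 ++ s) (s1 ++ s') (shift (size s1) w).
Proof.
case/andP => /eqP runw crw; rewrite /transports run_shift runw eqxx /=.
by rewrite /crossing all_map.
Qed.

Lemma transports_fill s1 s s' U u W :
    transports [::] (s1 ++ s) U -> transports s s' u ->
    transports (s1 ++ s') [::] W ->
  is_crossing_graph (U ++ shift (size s1) u ++ W).
Proof.
move=> trU /(transports_shift s1) tru trW.
exact: transports_cat trU (transports_cat tru trW).
Qed.

(** * The rotation number is half the total turning *)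

(** Twice the contribution to the rotation number of a half turn: the cup and the
    cap with left end [true], that is upwards, are traversed clockwise. *)
Definition sgn (b : bool) : int := if b then -1 else 1.

Lemma sgnN b : sgn (~~ b) = - sgn b. Proof. by case: b. Qed.

Definition turn (x : opiece) : int :=
  match x with OCup b => sgn b | OCap b => sgn b | OVert _ _ _ _ => 0 end.

Definition turning (w : oword) : int := \sum_(s <- w) turn s.1.

Lemma turning_cat A B : turning (A ++ B) = turning A + turning B.
Proof. by rewrite /turning big_cat. Qed.

Lemma turning_cons s B : turning (s :: B) = turn s.1 + turning B.
Proof. by rewrite /turning big_cons. Qed.

Definition rename (f : nat -> nat) (l : seq (nat * bool)) :=
  [seq (f p.1, p.2) | p <- l].

Lemma unzip1_rename f l : unzip1 (rename f l) = map f (unzip1 l).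
Proof. by rewrite /unzip1 /rename -!map_comp. Qed.

Lemma rename_id f l : {in unzip1 l, f =1 id} -> rename f l = l.
Proof.
move=> fE; rewrite -[RHS]map_id; apply/eq_in_map => -[x b] lx /=.
by rewrite fE //; apply/mapP; exists (x, b).
Qed.

(** [arcs l phi]: the curves scanned so far end in the strands [l], each given by
    the name of its component and its direction, and [phi] is the total turning
    of these arcs. Generating the list by inserting a pair of adjacent ends into
    a given list encodes at once that the arcs do not cross, that each has two
    ends of opposite directions, and that its turning depends only on the
    direction of its left end. *)
Inductive arcs : seq (nat * bool) -> int -> Prop :=
| arcs_nil : arcs [::] 0
| arcs_insert l1 l2 x b phi :
    arcs (l1 ++ l2) phi -> x \notin unzip1 (l1 ++ l2) ->
    arcs (l1 ++ [:: (x, b); (x, ~~ b)] ++ l2) (phi + sgn b).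

Lemma arcs_rename f l phi :
  arcs l phi -> {in unzip1 l &, injective f} -> arcs (rename f l) phi.
Proof.
move=> al; elim: al f => {l phi} [f _|l1 l2 x b phi _ IH fresh f inj_f].
  exact: arcs_nil.
have sub z : z \in unzip1 (l1 ++ l2) ->
    z \in unzip1 (l1 ++ [:: (x, b); (x, ~~ b)] ++ l2).
  rewrite /unzip1 !map_cat !mem_cat /= => /orP[->//|->]; by rewrite !orbT.
have memx : x \in unzip1 (l1 ++ [:: (x, b); (x, ~~ b)] ++ l2).
  by rewrite /unzip1 !map_cat !mem_cat inE eqxx orbT.
rewrite /rename !map_cat /=; apply: arcs_insert; rewrite -map_cat.
  by apply: IH => y z /sub my /sub mz; apply: inj_f.
rewrite -/(rename f _) unzip1_rename; apply/mapP => -[y my /inj_f xy].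
by move: fresh; rewrite xy ?my //; apply: sub.
Qed.

Lemma cat_pair_eq (T : Type) (l1 l2 m1 m2 : seq T) a b c d :
    l1 ++ [:: a; b] ++ l2 = m1 ++ [:: c; d] ++ m2 ->
  [/\ l1 = m1, l2 = m2, a = c & b = d] \/
  [\/ [/\ l1 = rcons m1 c, m2 = b :: l2 & a = d],
      [/\ m1 = rcons l1 a, l2 = d :: m2 & b = c],
      exists k, m1 = l1 ++ [:: a; b] ++ k /\ l2 = k ++ [:: c; d] ++ m2
    | exists k, l1 = m1 ++ [:: c; d] ++ k /\ m2 = k ++ [:: a; b] ++ l2].
Proof.
elim: l1 m1 => [|e l1 IH] [|f m1] /=.
- by case=> -> -> ->; left.
- case=> -> E; right; case: m1 E => [|g m1] /= [-> ->]; first by constructor 2.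
  by constructor 3; exists m1.
- case=> -> E; right; case: l1 {IH} E => [|g l1] /= [-> <-].
    by constructor 1.
  by constructor 4; exists l1.
case=> -> /IH [[-> -> -> ->]|[[-> -> ->]|[-> -> ->]|[k [-> ->]]|[k [-> ->]]]].
- by left.
- by right; constructor 1.
- by right; constructor 2.
- by right; constructor 3; exists k.
- by right; constructor 4; exists k.
Qed.

(** The component [y] is absorbed by [x], as in a cap joining them. *)
Definition fuse (x y : nat) (l : seq (nat * bool)) :=
  rename (fun z => if z == y then x else z) l.

Lemma mem_unzip1_cat l1 (p : nat * bool) l2 z :
  (z \in unzip1 (l1 ++ p :: l2)) = (z == p.1) || (z \in unzip1 (l1 ++ l2)).
Proof. by rewrite /unzip1 !map_cat !mem_cat inE orbCA. Qed.

Lemma fuse_fresh x y l : y \notin unzip1 l -> fuse x y l = l.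
Proof.
by move=> fresh; apply: rename_id => z lz; case: eqP lz fresh => // -> ->.
Qed.

Lemma arcs_cup l1 l2 k b phi :
    arcs (l1 ++ l2) phi -> {in unzip1 (l1 ++ l2), forall x, x < k}%N ->
  arcs (l1 ++ [:: (k, b); (k, ~~ b)] ++ l2) (phi + sgn b).
Proof.
move=> al lt_k; apply: arcs_insert => //.
by apply/negP => /lt_k; rewrite ltnn.
Qed.

(** A cap on a single arc closes a circle, so the turning of that arc leaves
    [phi]. A cap joining two arcs adds its own sign; that the resulting arc
    again turns according to its left end is where planarity is used: the
    statement fails for crossing arcs. *)
Lemma arcs_cap l1 l2 x y b phi :
    arcs (l1 ++ [:: (x, b); (y, ~~ b)] ++ l2) phi ->
  if x == y then arcs (l1 ++ l2) (phi - sgn b)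
  else arcs (fuse x y (l1 ++ l2)) (phi + sgn b).
Proof.
move E: (l1 ++ _) => l al; elim: al => {l phi} [|m1 m2 z c phi am IH fresh]
  in l1 l2 x y b E *.
  by move/(congr1 size): E; rewrite !size_cat !addnS.
have insert k1 k2 psi : arcs (k1 ++ k2) psi -> z \notin unzip1 (k1 ++ k2) ->
    arcs (k1 ++ [:: (z, c); (z, ~~ c)] ++ k2) (psi + sgn c).
  exact: arcs_insert.
have fuse_insert k1 k2 : x != y -> z != x -> z != y ->
    arcs (fuse x y (k1 ++ k2)) (phi + sgn b) -> z \notin unzip1 (k1 ++ k2) ->
    arcs (fuse x y (k1 ++ [:: (z, c); (z, ~~ c)] ++ k2)) (phi + sgn c + sgn b).
  move=> xy zx zy ak zk; rewrite addrAC /fuse /rename !map_cat /=.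
  rewrite (negPf zy); apply: insert; rewrite -map_cat //.
  rewrite -[map _ _]/(fuse x y (k1 ++ k2)) unzip1_rename.
  apply/mapP => -[t tk].
  case: ifP => _ zE; first by rewrite zE eqxx in zx.
  by rewrite zE tk in zk.
(* Compare the capped pair with the pair of ends inserted last. *)
have [[-> -> [-> ->] [->]]|] := cat_pair_eq E.
  by rewrite eqxx addrK.
case=> [[l1E m2E [xE bE]]|[m1E l2E [yE bE]]|[k [m1E l2E]]|[k [l1E m2E]]].
(* The cap joins the right end of the last arc to the end of y: the two arcs
   straighten into one, which takes the place of the arc y under the name z. *)
- have cE : c = ~~ b by rewrite bE negbK.
  move: fresh; rewrite m2E mem_unzip1_cat negb_or => /andP[zy fresh].
  rewrite xE (negPf zy) l1E cat_rcons cE sgnN subrK.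
  have -> : fuse z y (m1 ++ (z, ~~ b) :: l2) = fuse z y (m1 ++ (y, ~~ b) :: l2).
    by rewrite /fuse /rename !map_cat /= eqxx (negPf zy).
  apply: arcs_rename; first by rewrite -m2E.
  move=> t u; rewrite !mem_unzip1_cat /= => tm um.
  have sub v : (v == y) || (v \in unzip1 (m1 ++ l2)) -> v != z.
    by case/orP => [/eqP-> //|vm]; [rewrite eq_sym | apply: contraNneq fresh => <-].
  case: (eqVneq t y) => [->|_]; case: (eqVneq u y) => [->//|_] //= tu.
    by have := sub _ um; rewrite -tu eqxx.
  by have := sub _ tm; rewrite tu eqxx.
(* The mirror image: the arc z disappears into the arc x. *)
- have := fresh; rewrite m1E cat_rcons mem_unzip1_cat negb_or => /andP[zx zl].
  rewrite yE eq_sym (negPf zx) l2E.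
  rewrite -bE sgnN subrK.
  have -> : fuse x z (l1 ++ (z, ~~ ~~ b) :: m2) = m1 ++ m2.
    rewrite -[RHS](@fuse_fresh x z) // m1E cat_rcons.
    rewrite /fuse /rename !map_cat /= eqxx (eq_sym x) (negPf zx) negbK.
    by [].
  by [].
(* The two pairs are disjoint: cap first, insert afterwards. *)
- move: fresh; rewrite m1E -!catA !cat_cons.
  rewrite !mem_unzip1_cat !negb_or /= => /and3P[zx zy fresh].
  have /= := IH l1 (k ++ m2) x y b; rewrite m1E -!catA => /(_ erefl).
  rewrite l2E; case: (boolP (x == y)) => [_ a_|xy a_].
    by rewrite addrAC catA; apply: insert; rewrite -?catA.
  by rewrite catA; apply: fuse_insert; rewrite -?catA.
- move: fresh; rewrite m2E catA -[[:: _; _] ++ l2]/(_ :: _ :: l2).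
  rewrite !mem_unzip1_cat !negb_or /= => /and3P[zx zy fresh].
  have /= := IH (m1 ++ k) l2 x y b; rewrite m2E -!catA => /(_ erefl).
  rewrite l1E -!catA; case: (boolP (x == y)) => [_ a_|xy a_].
    by rewrite addrAC; apply: insert; rewrite // catA.
  by apply: fuse_insert; rewrite // catA.
Qed.

Definition vertexless (w : oword) : bool :=
  all (fun s => if s.1 is OVert _ _ _ _ then false else true) w.

Lemma map_eq_cat (T S : Type) (f : T -> S) l s1 s2 :
    map f l = s1 ++ s2 ->
  exists l1 l2, [/\ l = l1 ++ l2, map f l1 = s1 & map f l2 = s2].
Proof.
move=> E; exists (take (size s1) l), (drop (size s1) l).
by rewrite cat_take_drop map_take map_drop E take_size_cat ?drop_size_cat.
Qed.

(** Each circle is counted at its highest cap, where it has the sign of that cap;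
    together with the equal turning of the arc closed there, this is the sum of
    all its half turns. *)
Lemma circles_sum_turning G l k phi :
    vertexless G -> arcs l phi -> {in unzip1 l, forall x, x < k}%N ->
    run (unzip2 l) G = Some [::] ->
  circles_sum (unzip1 l) k G *+ 2 = turning G + phi.
Proof.
elim: G l k phi => [|[x i] G IH] l k phi.
  move=> _ al _ [l0]; rewrite /turning big_nil add0r mul0rn.
  case: al l0 => // l1 l2 y b psi _ _ /(congr1 size).
  by rewrite /unzip2 size_map !size_cat !addnS.
move=> /= /andP[noVx noV] al lt_k; rewrite turning_cons.
move/run_split => [s1 [s2 [/map_eq_cat[l1 [l' [lE <- lE']]] s1i _ runG]]].
have {lE'} [l2 [l3 [l'E l2E l3E]]] := map_eq_cat lE'; subst l' l s2.
have {s1i} l1i : size l1 = i by rewrite -s1i size_map.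
have takeE : take i (unzip1 (l1 ++ l2 ++ l3)) = unzip1 l1.
  by rewrite {1}/unzip1 map_cat take_size_cat ?size_map.
have dropE : drop i (unzip1 (l1 ++ l2 ++ l3)) = unzip1 (l2 ++ l3).
  by rewrite {1}/unzip1 map_cat drop_size_cat ?size_map.
case: x => [b|b|//] /= in noVx l2E runG *.
  case: l2 l2E => //= _ in al lt_k takeE dropE runG *.
  rewrite takeE dropE.
  have lt_k' : {in unzip1 (l1 ++ [:: (k, b); (k, ~~ b)] ++ l3),
                forall x, x < k.+1}%N.
    move=> z; rewrite !mem_unzip1_cat /= => /or3P[/eqP->|/eqP->|] //.
    by move/lt_k/ltnW.
  have := IH _ _ _ noV (arcs_cup b al lt_k) lt_k'.
  rewrite /unzip1 /unzip2 !map_cat /= => /(_ runG) ->.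
  by rewrite addrA addrC addrA.
case: l2 l2E => [|[y c] [|[z d] []]] //= [cb db] in al lt_k takeE dropE runG *.
rewrite takeE -addn2 addnC -drop_drop dropE.
have -> : nth 0%N (unzip1 (l1 ++ [:: (y, c); (z, d)] ++ l3)) i = y.
  by rewrite /unzip1 map_cat nth_cat size_map l1i ltnn subnn.
have -> : nth 0%N (unzip1 (l1 ++ [:: (y, c); (z, d)] ++ l3)) i.+1 = z.
  rewrite /unzip1 map_cat nth_cat size_map l1i ltnNge leqnSn /=.
  by rewrite subSn // subnn.
have := arcs_cap (l1 := l1) (l2 := l3) (x := y) (y := z) (b := b) (phi := phi).
rewrite -db -cb => /(_ al).
have sub t : t \in unzip1 (l1 ++ l3) -> (t < k)%N.
  by move=> tl; apply: lt_k; rewrite !mem_unzip1_cat tl !orbT.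
case: eqP => [_ al'|_ al'] /=.
  have := IH (l1 ++ l3) k _ noV al' sub.
  rewrite /unzip1 /unzip2 !map_cat drop0 => /(_ runG) Esum.
  rewrite mulrnDl Esum -/(sgn c).
  ring.
have lt_k' : {in unzip1 (fuse y z (l1 ++ l3)), forall x, x < k}%N.
  move=> t; rewrite unzip1_rename => /mapP[u ul ->].
  case: ifP => _; last exact: sub.
  by apply: lt_k; rewrite !mem_unzip1_cat eqxx.
have := IH _ _ _ noV al' lt_k'.
have -> : unzip2 (fuse y z (l1 ++ l3)) = unzip2 (l1 ++ l3).
  by rewrite /unzip2 /fuse /rename -map_comp.
rewrite unzip1_rename /unzip1 /unzip2 !map_cat drop0 => /(_ runG) ->.
by rewrite addrA addrC addrA.
Qed.

(** Splicing preserves the turning because a crossing-type vertex is replaced either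
    by vertical arcs or by a cap and a cup of opposite signs. *)
Lemma run_splice G s s' :
    crossing G -> run s G = Some s' ->
  [/\ run s (splice G) = Some s', vertexless (splice G)
    & turning (splice G) = turning G].
Proof.
elim: G s => [|[x i] G IH] s //= /andP[nonalt crG].
move/run_split => [s1 [s2 [-> s1i bal /IH - /(_ crG) [runG noV turnG]]]].
rewrite turning_cons /splice /= -/(splice G).
case: x => [b|b|a b c d] /= in nonalt bal runG *.
- by rewrite turning_cons turnG run_cup.
- by rewrite turning_cons turnG run_cap.
case: eqP => [ab|/eqP nab] /=.
  rewrite add0r; split => //; rewrite -runG ab in bal *.
  by case: b c d bal {runG nonalt ab} => -[] [].
(* The cap and the cup of the splice have opposite signs. *)
have [bE cE dE] : [/\ b = ~~ a, c = ~~ a & d = a].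
  by case: a b c d nonalt bal nab {runG} => -[] [] [].
rewrite !turning_cons turnG /= cE sgnN addrA subrr !add0r; split => //.
rewrite bE run_cap //.
rewrite run_cup //.
by rewrite -runG cE dE /= negbK.
Qed.

(** The rotation number becomes local: it does not see how the cups and caps
    are connected. *)
Lemma rotation_number_turning G :
  is_crossing_graph G -> rotation_number G *+ 2 = turning G.
Proof.
case/andP => /eqP runG crG; have [runS noV <-] := run_splice crG runG.
by rewrite (circles_sum_turning (l := [::]) noV arcs_nil) ?addr0.
Qed.

Lemma rotation_number_eq G H :
    is_crossing_graph G -> is_crossing_graph H -> turning G = turning H ->
  rotation_number G = rotation_number H.
Proof.
move=> crG crH; rewrite -!rotation_number_turning //.
by move/eqP; rewrite eqrMn2r // => /eqP.
Qed.

Lemma bracket_crossing_move n R (hR : is_MOY n R) U u v W :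
    omove u v -> turning u = turning v ->
    is_crossing_graph (U ++ u ++ W) -> is_crossing_graph (U ++ v ++ W) ->
  bracket_crossing n R (U ++ u ++ W) = bracket_crossing n R (U ++ v ++ W).
Proof.
move=> uv tuv cru crv; rewrite /bracket_crossing (MOY_isotopy hR uv) //.
by rewrite (rotation_number_eq cru crv) // !turning_cat tuv.
Qed.

(** * Expansion of alternating vertices *)

(** The expansion of a single piece. All pieces that replace a vertex sit at the
    same distance from the left as the vertex, which is therefore left out. *)
Definition smoothings (x : opiece) : seq (LF * seq opiece) :=
  match x with
  | OVert a b c d =>
      if alternating x then
        [:: (q, if a then [::] else [:: OCap a; OCup c]);
            (q^-1, if a then [:: OCap a; OCup c] else [::])]
      else [:: (1, [:: x])]
  | _ => [:: (1, [:: x])]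
  end.

Definition stack (i : nat) (X : seq opiece) : oword := [seq (x, i) | x <- X].

Lemma shift_cat (T : Type) i (u v : seq (T * nat)) :
  shift i (u ++ v) = shift i u ++ shift i v.
Proof. exact: map_cat. Qed.

Lemma shift_stack i j X : shift i (stack j X) = stack (i + j) X.
Proof. by rewrite /shift /stack -map_comp. Qed.

Lemma expand_cons x i G :
  expand ((x, i) :: G) =
  [seq (t.1 * u.1, stack i t.2 ++ u.2) | t <- smoothings x, u <- expand G].
Proof.
case: x => [b|b|a b c d] /=; rewrite ?cats0.
1,2: by apply: eq_map => t; rewrite mul1r.
case: ifP => _ /=; rewrite ?cats0; last by apply: eq_map => t; rewrite mul1r.
by case: a.
Qed.

Arguments expand : simpl never.

Lemma big_expand_cons (x : opiece) i G (f : LF * oword -> LF) :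
  \sum_(t <- expand ((x, i) :: G)) f t =
  \sum_(t <- smoothings x) \sum_(u <- expand G)
     f (t.1 * u.1, stack i t.2 ++ u.2).
Proof. by rewrite expand_cons big_allpairs_dep. Qed.

Lemma big_expand_cat A B (f : LF * oword -> LF) :
  \sum_(t <- expand (A ++ B)) f t =
  \sum_(t <- expand A) \sum_(u <- expand B) f (t.1 * u.1, t.2 ++ u.2).
Proof.
elim: A f => [|[x i] A IH] f.
  rewrite [expand [::]]/expand big_seq1; apply: eq_bigr => -[c w] _ /=.
  by rewrite mul1r.
rewrite cat_cons !big_expand_cons; apply: eq_bigr => t _.
rewrite IH; apply: eq_bigr => u _; apply: eq_bigr => v _ /=.
by rewrite mulrA catA.
Qed.

Lemma expand_crossing o : crossing o -> expand o = [:: (1, o)].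
Proof.
elim: o => [//|[x j] o IH] /= /andP[nx /IH E]; rewrite expand_cons E.
have -> : smoothings x = [:: (1, [:: x])].
  by case: x nx => // a b c d; rewrite /smoothings => /negbTE->.
by rewrite /= mulr1.
Qed.

Lemma expand_shift i o :
  expand (shift i o) = [seq (t.1, shift i t.2) | t <- expand o].
Proof.
elim: o => [//|[x j] o IH].
rewrite shift_cons expand_cons IH.
rewrite [expand (_ :: o)]expand_cons map_allpairs allpairs_mapr.
apply: eq_allpairs => t u; rewrite /shift map_cat; congr (_, _ ++ _).
by rewrite /stack -map_comp.
Qed.

Lemma all_allpairs_of (S T U : Type) (P : pred U) (Q : pred S) (Q' : pred T)
    (f : S -> T -> U) r r' :
    all Q r -> all Q' r' -> (forall x y, Q x -> Q' y -> P (f x y)) ->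
  all P [seq f x y | x <- r, y <- r'].
Proof.
move=> + Qr' QP; elim: r => [//|x r IH] /= /andP[Qx /IH Pr].
rewrite all_cat Pr andbT all_map; apply: sub_all Qr' => y; exact: QP.
Qed.

Lemma all_allpairsE (S T U : Type) (P : pred U) (f : S -> T -> U) r r' :
  all P [seq f x y | x <- r, y <- r'] = all (fun x => all (fun y => P (f x y)) r') r.
Proof.
elim: r => [//|x r IH] /=.
by rewrite all_cat all_map IH.
Qed.

Lemma all_In (T : Type) (P : pred T) (r : seq T) t :
  all P r -> List.In t r -> P t.
Proof.
by elim: r => [//|u r IH] /= /andP[Pu Pr] [<- //|]; apply: IH.
Qed.

(** [List.In] takes the place of boolean membership since pieces carry no
    decidable equality. *)
Lemma eq_big_In (T : Type) (r : seq T) (F F' : T -> LF) :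
    (forall t, List.In t r -> F t = F' t) ->
  \sum_(t <- r) F t = \sum_(t <- r) F' t.
Proof.
elim: r => [|t r IH] FF'; first by rewrite !big_nil.
by rewrite !big_cons FF' ?IH //=; [move=> u ru; apply: FF'; right | left].
Qed.

Lemma smoothings_transport s1 s2 x i :
    size s1 = i -> balanced x ->
  all (fun t => transports (s1 ++ legs_in x ++ s2) (s1 ++ legs_out x ++ s2)
                           (stack i t.2)) (smoothings x).
Proof.
move=> s1i bal.
have triv y : balanced y -> ~~ alternating y ->
    transports (s1 ++ legs_in y ++ s2) (s1 ++ legs_out y ++ s2) (stack i [:: y]).
  move=> baly nalty; rewrite /transports run_step_legs // run_nil eqxx.
  by rewrite /crossing /= nalty.
have hv a c : transports (s1 ++ [:: a; ~~ a] ++ s2) (s1 ++ [:: c; ~~ c] ++ s2)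
     (stack i [:: OCap a; OCup c]).
  by rewrite /transports /= run_cap // run_cup // run_nil eqxx.
case: x bal => [b|b|a b c d] bal; rewrite /smoothings ?all_seq1 ?triv //.
case: ifP => [/and3P[_ /eqP ad /eqP bc]|/negbT nalt].
  have [-> -> ->] : [/\ b = ~~ a, c = a & d = ~~ a].
    by case: a b c d bal ad bc => -[] [] [].
  have vert s : transports s s [::] by rewrite /transports eqxx.
  by case: a {bal ad} => /=; rewrite !vert -?[~~ true]/false ?hv.
by rewrite all_seq1 triv.
Qed.

Lemma expand_transport G s s' :
  run s G = Some s' -> all (fun t => transports s s' t.2) (expand G).
Proof.
elim: G s => [s [<-]|[x i] G IH s]; first by rewrite /expand /= /transports eqxx.
move/run_split => [s1 [s2 [-> s1i bal /IH trG]]]; rewrite expand_cons.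
apply: all_allpairs_of (smoothings_transport s2 s1i bal) trG _ => t u.
exact: transports_cat.
Qed.

(** * Summation over the orientations of a disk *)

Lemma labellings_cat A B :
  labellings (A ++ B) = [seq a ++ b | a <- labellings A, b <- labellings B].
Proof.
elim: A => [|s A IH]; first by rewrite /= cats0 map_id.
rewrite [LHS]/= IH -[labellings (s :: A)]/(allpairs cons _ _).
elim: (labellings1 s) => [//|t r IHr].
by rewrite !allpairs_cons allpairs_cat IHr allpairs_mapl map_allpairs.
Qed.

Definition oriented (x : piece) : seq opiece :=
  [seq t.1 | t <- labellings1 (x, 0%N)].

Lemma labellings1E x i : labellings1 (x, i) = stack i (oriented x).
Proof. by case: x. Qed.

Lemma labellings_cons x i w :
  labellings ((x, i) :: w) = [seq (y, i) :: o | y <- oriented x, o <- labellings w].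
Proof. by rewrite /= -/(labellings1 (x, i)) labellings1E allpairs_mapl. Qed.

Arguments labellings : simpl never.

Lemma labellings_shift i u :
  labellings (shift i u) = map (shift i) (labellings u).
Proof.
elim: u => [//|[x j] u IH].
rewrite shift_cons !labellings_cons IH.
by rewrite map_allpairs allpairs_mapr.
Qed.

Lemma oriented_arity x :
  all (fun y => (size (legs_in y) == arity_in x) &&
                (size (legs_out y) == arity_out x)) (oriented x).
Proof. by case: x. Qed.

Lemma labellings_width w s m :
    width (size s) w = Some m ->
  all (fun o => if run s o is Some s' then size s' == m else true)
      (labellings w).
Proof.
elim: w s => [s [<-]|[x i] w IH s]; first by rewrite /= eqxx.
rewrite labellings_cons all_allpairsE [width _ _]/=; case: ifP => // le_s wE.
apply: sub_all (oriented_arity x) => y /andP[/eqP sy_in /eqP sy_out] /=.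
set C := [&& (i <= size s)%N,
             take (size (legs_in y)) (drop i s) == legs_in y & balanced y].
have runE o : run s ((y, i) :: o) = if C
    then run (take i s ++ legs_out y ++ drop (i + size (legs_in y)) s) o
    else None by [].
have [C1|/negbTE nC] := boolP C; last first.
  by rewrite (@eq_all _ _ predT) ?all_predT // => o; rewrite runE nC.
have /and3P[le_is _ _] := C1.
apply: etrans (eq_all _ _) (IH _ _); first by move=> o /=; rewrite runE C1.
rewrite -wE !size_cat size_takel // size_drop sy_in sy_out.
congr width; rewrite addnCA addnC; congr addn.
by rewrite subnDA addnBA ?leq_subRL // [(i + _)%N]addnC subnK.
Qed.

(** The contribution of one orientation [o] of a disk, for a crossing-type
    exterior. *)
Definition filling (n : nat) (R : oword -> LF) (U W : oword) (i : nat)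
    (o : oword) : LF :=
  \sum_(t <- expand o) t.1 * bracket_crossing n R (U ++ shift i t.2 ++ W).

Lemma filling_crossing n R U W i o :
  crossing o -> filling n R U W i o = bracket_crossing n R (U ++ shift i o ++ W).
Proof. by move=> cr; rewrite /filling expand_crossing // big_seq1 mul1r. Qed.

(** The smoothing that turns left is the vertical one exactly when the lower left
    end comes in, which decides which coefficient is [q]. *)
Lemma filling_alternating n R U W i A B p j :
    crossing A -> crossing B ->
  filling n R U W i (A ++ (OVert p (~~ p) p (~~ p), j) :: B) =
  (if p then q else q^-1) *
    bracket_crossing n R (U ++ shift i (A ++ B) ++ W) +
  (if p then q^-1 else q) *
    bracket_crossing n R
      (U ++ shift i (A ++ [:: (OCap p, j); (OCup p, j)] ++ B) ++ W).
Proof.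
move=> crA crB.
rewrite /filling big_expand_cat expand_crossing // big_seq1 big_expand_cons.
rewrite expand_crossing //.
have -> : smoothings (OVert p (~~ p) p (~~ p)) =
    [:: (q, if p then [::] else [:: OCap p; OCup p]);
        (q^-1, if p then [:: OCap p; OCup p] else [::])].
  by case: p.
rewrite big_cons !big_seq1 /= !mul1r !mulr1.
by case: p => /=; rewrite // addrC.
Qed.

(** The contribution of all orientations of a disk: [s] are the strands that
    enter it from below, and [P] tells which strands the exterior accepts
    above it. *)
Definition local_sum (n : nat) (R : oword -> LF) (P : pred (seq bool))
    (s : seq bool) (U W : oword) (i : nat) (u : word) : LF :=
  \sum_(o <- labellings u | oapp P false (run s o))
    filling n R U W i o.

Lemma local_sum_nil n R P s U W i :
  local_sum n R P s U W i [::] =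
  if P s then bracket_crossing n R (U ++ W) else 0.
Proof.
by rewrite /local_sum /labellings big_mkcond big_seq1 /= filling_crossing.
Qed.

(** Once the strands that enter a small disk are given, few of its labellings are
    orientations; [f] parametrizes these. *)
Lemma local_sum_map (T : Type) (L : seq T) (f : T -> oword) n R P s U W i u :
    [seq o <- labellings u | run s o] = [seq f t | t <- L] ->
  local_sum n R P s U W i u =
  \sum_(t <- L | oapp P false (run s (f t))) filling n R U W i (f t).
Proof.
move=> E; rewrite /local_sum -(big_map f (fun o => oapp P false (run s o))) -E.
rewrite big_filter_cond; apply: eq_bigl => o.
by case: (run s o).
Qed.

(** The expansion of the exterior and the choice of its orientation commute with
    everything done inside the disk, so a relation between evaluations need only
    be checked in the disk, for each crossing-type exterior. *)
Lemma evaluation_local (n : nat) (R : oword -> LF) (c : LF) (U W u v : word)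
    (i m : nat) :
    width 0 U = Some (i + m)%N ->
    (forall (P : pred (seq bool)) s1 s oU oW, size s1 = i -> size s = m ->
       transports [::] (s1 ++ s) oU ->
       (forall s', P s' -> transports (s1 ++ s') [::] oW) ->
       local_sum n R P s oU oW i u = c * local_sum n R P s oU oW i v) ->
  evaluation n R (U ++ shift i u ++ W) = c * evaluation n R (U ++ shift i v ++ W).
Proof.
move=> widthU local.
have evalE w : evaluation n R (U ++ shift i w ++ W) =
    \sum_(oU <- labellings U) \sum_(oW <- labellings W)
      \sum_(o <- labellings w | is_ograph (oU ++ shift i o ++ oW))
        \sum_(tU <- expand oU) \sum_(tW <- expand oW) \sum_(t <- expand o)
          tU.1 * (t.1 * tW.1) * bracket_crossing n R (tU.2 ++ shift i t.2 ++ tW.2).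
  rewrite /evaluation big_filter labellings_cat big_mkcond big_allpairs_dep.
  apply: eq_bigr => oU _; rewrite labellings_cat big_allpairs_dep.
  rewrite labellings_shift big_map exchange_big; apply: eq_bigr => oW _.
  rewrite -big_mkcond; apply: eq_bigr => o _.
  rewrite /bracket big_expand_cat; apply: eq_bigr => tU _.
  rewrite big_expand_cat expand_shift big_map exchange_big.
  by apply: eq_bigr => tW _; apply: eq_bigr => t _.
rewrite !evalE mulr_sumr; apply: eq_big_In => oU /(all_In
  (labellings_width (s := [::]) widthU)) sz_oU.
rewrite mulr_sumr; apply: eq_bigr => oW _.
case runU: (run [::] oU) sz_oU => [s0|] => [/eqP s0E|_]; last first.
  have no_ograph o : is_ograph (oU ++ shift i o ++ oW) = false.
    by rewrite /is_ograph run_cat runU.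
  by rewrite !big_pred0 ?mulr0 // => o; rewrite no_ograph.
have sz1 : size (take i s0) = i by rewrite size_takel // s0E leq_addr.
have sz2 : size (drop i s0) = m by rewrite size_drop s0E addKn.
move: s0E runU; rewrite -(cat_take_drop i s0).
move: (take i s0) (drop i s0) sz1 sz2 => s1 s sz1 sz2 _ runU.
(* The orientations of the exterior enter only through the strands that leave
   the disk upwards: P singles out those that W can absorb. *)
pose P s' := run (s1 ++ s') oW == Some [::].
have ographE o : is_ograph (oU ++ shift i o ++ oW) = oapp P false (run s o).
  rewrite /is_ograph run_cat runU /= run_cat -sz1 run_shift.
  by case: (run s o).
have sumE w : \sum_(o <- labellings w | is_ograph (oU ++ shift i o ++ oW))
      \sum_(tU <- expand oU) \sum_(tW <- expand oW) \sum_(t <- expand o)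
        tU.1 * (t.1 * tW.1) * bracket_crossing n R (tU.2 ++ shift i t.2 ++ tW.2)
    = \sum_(tU <- expand oU) \sum_(tW <- expand oW) tU.1 * tW.1 *
        local_sum n R P s tU.2 tW.2 i w.
  under eq_bigl => o do rewrite ographE.
  rewrite exchange_big; apply: eq_bigr => tU _.
  rewrite exchange_big; apply: eq_bigr => tW _.
  rewrite mulr_sumr; apply: eq_bigr => o _.
  rewrite mulr_sumr; apply: eq_bigr => t _.
  by rewrite [t.1 * tW.1]mulrC !mulrA.
rewrite !sumE mulr_sumr; apply: eq_big_In => tU inU.
rewrite mulr_sumr; apply: eq_big_In => tW inW.
have trU := all_In (expand_transport runU) inU.
have trW s' : P s' -> transports (s1 ++ s') [::] tW.2.
  by move=> /eqP runW; apply: (all_In (expand_transport runW) inW).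
by rewrite (local P s1 s _ _ sz1 sz2 trU trW) mulrCA.
Qed.

(** * Exchanges of heights *)

Lemma run_exchange s x y i k w :
    (i + size (legs_in x) + k + size (legs_in y) <= size s)%N ->
  run s [:: (y, i + size (legs_in x) + k)%N, (x, i) & w] =
  run s [:: (x, i), (y, i + size (legs_out x) + k)%N & w].
Proof.
move=> le_s.
have [a [b [c [d [e [-> sa sb sc sd]]]]]] : exists a b c d e,
    [/\ s = a ++ b ++ c ++ d ++ e, size a = i, size b = size (legs_in x),
        size c = k & size d = size (legs_in y)].
  have cut (t : seq bool) j : (j <= size t)%N ->
      exists t1 t2, t = t1 ++ t2 /\ size t1 = j.
    move=> le_j; exists (take j t), (drop j t).
    by rewrite cat_take_drop size_takel.
  move: le_s; rewrite -!addnA => le_s.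
  have [|a [s1 [E sa]]] := cut s i; first exact: leq_trans (leq_addr _ _) le_s.
  move: le_s; rewrite E size_cat sa leq_add2l => le_s.
  have [|b [s2 [E2 sb]]] := cut s1 (size (legs_in x)).
    exact: leq_trans (leq_addr _ _) le_s.
  move: le_s; rewrite E2 size_cat sb leq_add2l => le_s.
  have [|c [s3 [E3 sc]]] := cut s2 k; first exact: leq_trans (leq_addr _ _) le_s.
  move: le_s; rewrite E3 size_cat sc leq_add2l => /cut[d [e [E4 sd]]].
  by exists a, b, c, d, e; rewrite E4.
rewrite (catA b) (catA a) run_step //; last by rewrite !size_cat sa sb sc addnA.
rewrite -!catA [in RHS]run_step //.
have -> : (if (d == legs_in y) && balanced y
           then run (a ++ b ++ c ++ legs_out y ++ e) ((x, i) :: w) else None) =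
          if (d == legs_in y) && balanced y then
            if (b == legs_in x) && balanced x then
              run (a ++ legs_out x ++ c ++ legs_out y ++ e) w else None
          else None.
  by rewrite run_step.
have -> : run (a ++ legs_out x ++ c ++ d ++ e)
            ((y, (i + size (legs_out x) + k)%N) :: w) =
          if (d == legs_in y) && balanced y then
            run (a ++ legs_out x ++ c ++ legs_out y ++ e) w else None.
  rewrite (catA (legs_out x)) (catA a) run_step //; first by rewrite -!catA.
  by rewrite !size_cat sa sc addnA.
by case: ifP; case: ifP.
Qed.

Lemma exchange_move x y i k :
  omove [:: (y, i + size (legs_in x) + k)%N; (x, i)]
        [:: (x, i); (y, i + size (legs_out x) + k)%N].
Proof.
rewrite /omove /=.
have -> : size (legs_in x) = arity_in (Defs.shape (x, i)).1 by case: x.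
have -> : size (legs_out x) = arity_out (Defs.shape (x, i)).1 by case: x.
exact: Exchange.
Qed.

Lemma exchange_crossing n R (hR : is_MOY n R) U W x y i k :
  let u := [:: (y, i + size (legs_in x) + k)%N; (x, i)] in
  let v := [:: (x, i); (y, i + size (legs_out x) + k)%N] in
  is_crossing_graph (U ++ u ++ W) ->
  is_crossing_graph (U ++ v ++ W) /\
  bracket_crossing n R (U ++ u ++ W) = bracket_crossing n R (U ++ v ++ W).
Proof.
move=> u v cru.
have crv : is_crossing_graph (U ++ v ++ W).
  have [s [trU /transports_split[s' [/andP[/eqP runu cr] trW]]]] :=
    transports_split cru.
  apply: (transports_cat trU (transports_cat _ trW)); apply/andP; split.
    rewrite -run_exchange ?runu //.
    move/run_split: runu => [s1 [s2 [-> s1i _ _]]].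
    by rewrite !size_cat s1i leq_add2l leq_addr.
  by move: cr; rewrite /crossing /= !andbT andbC.
split=> //; apply: bracket_crossing_move (exchange_move x y i k) _ cru crv => //.
by rewrite !turning_cons addrCA.
Qed.

(** One piece slides past a whole column, one exchange at a time. *)
Lemma exchange_stack n R (hR : is_MOY n R) U W x Y i k :
  let u := stack (i + size (legs_in x) + k) Y ++ [:: (x, i)] in
  let v := (x, i) :: stack (i + size (legs_out x) + k) Y in
  is_crossing_graph (U ++ u ++ W) ->
  is_crossing_graph (U ++ v ++ W) /\
  bracket_crossing n R (U ++ u ++ W) = bracket_crossing n R (U ++ v ++ W).
Proof.
elim: Y U => [//|y Y IH] U /= cru.
have := IH (rcons U (y, (i + size (legs_in x) + k)%N)).
rewrite /= !cat_rcons => /(_ cru) [cr1 ->].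
exact: exchange_crossing cr1.
Qed.

(** What a piece can become in the expansion: itself, or, for a vertex, one of the
    two smoothings. *)
Definition smoothed (x : opiece) (X : seq opiece) : Prop :=
  X = [:: x] \/
  size (legs_in x) = 2 /\ size (legs_out x) = 2 /\
  (X = [::] \/ exists a c, X = [:: OCap a; OCup c]).

Lemma smoothings_shape x t : List.In t (smoothings x) -> smoothed x t.2.
Proof.
case: x => [b|b|a b c d]; rewrite /smoothings.
1,2: by case=> // <-; left.
case: ifP => _; last by case=> // <-; left.
have hv (e : bool) : smoothed (OVert a b c d) (if e then [::] else [:: OCap a; OCup c]).
  by right; do 2!split => //; case: e; [left | right; exists a, c].
case=> [<-|[<-|//]] /=; first exact: hv.
by have := hv (~~ a); rewrite if_neg.
Qed.

(** A smoothing has as many ends below and above as the vertex, so whatever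
    replaces two far apart pieces can still exchange heights. *)
Lemma exchange_smoothed n R (hR : is_MOY n R) U W x X Y i k :
  smoothed x X ->
  let u := stack (i + size (legs_in x) + k) Y ++ stack i X in
  let v := stack i X ++ stack (i + size (legs_out x) + k) Y in
  is_crossing_graph (U ++ u ++ W) ->
  bracket_crossing n R (U ++ u ++ W) = bracket_crossing n R (U ++ v ++ W).
Proof.
case=> [->|[-> [-> []]]].
- by move=> u v /(exchange_stack hR) [].
- by move=> -> /=; rewrite cats0.
case=> a [c ->] u v cru.
have E : U ++ u ++ W =
    U ++ (stack (i + 2 + k) Y ++ [:: (OCap a, i)]) ++ (OCup c, i) :: W.
  by rewrite /u -!catA.
rewrite E in cru *.
have [cr1 ->] := exchange_stack (x := OCap a) hR cru.
have := @exchange_stack n R hR (rcons U (OCap a, i)) W (OCup c) Y i k.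
by rewrite /= !cat_rcons -!catA => /(_ cr1) [_ ->].
Qed.

Lemma filling_exchange n R (hR : is_MOY n R) s1 s s' U W x y k :
    transports [::] (s1 ++ s) U -> transports (s1 ++ s') [::] W ->
    run s [:: (y, size (legs_in x) + k)%N; (x, 0%N)] = Some s' ->
  filling n R U W (size s1) [:: (y, size (legs_in x) + k)%N; (x, 0%N)] =
  filling n R U W (size s1) [:: (x, 0%N); (y, size (legs_out x) + k)%N].
Proof.
move=> trU trW runu; rewrite /filling.
have one (o : opiece) j (f : LF * oword -> LF) :
    \sum_(t <- expand [:: (o, j)]) f t =
    \sum_(t <- smoothings o) f (t.1, stack j t.2).
  rewrite big_expand_cons; apply: eq_bigr => t _.
  by rewrite [expand _]/expand big_seq1 /= mulr1 cats0.
rewrite !big_expand_cons.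
under eq_bigr => t _ do rewrite one.
under [RHS]eq_bigr => t _ do rewrite one.
rewrite [RHS]exchange_big.
apply: eq_big_In => ty iny; apply: eq_big_In => tx inx /=.
rewrite (mulrC tx.1); congr (_ * _).
have := expand_transport runu; rewrite expand_cons all_allpairsE => all_y.
have := all_In all_y iny; rewrite expand_cons all_allpairsE => all_x.
have := all_In all_x inx; rewrite /= andbT cats0 => /(transports_fill trU)/(_ trW).
rewrite !shift_cat !shift_stack addn0 !addnA => cru.
exact: (exchange_smoothed hR) (smoothings_shape inx) cru.
Qed.

Lemma local_sum_exchange n R (hR : is_MOY n R) (P : pred (seq bool))
    s1 s U W (x y : piece) k :
    transports [::] (s1 ++ s) U ->
    (forall s', P s' -> transports (s1 ++ s') [::] W) ->
    (arity_in x + k + arity_in y <= size s)%N ->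
  local_sum n R P s U W (size s1) [:: (y, arity_in x + k)%N; (x, 0%N)] =
  local_sum n R P s U W (size s1) [:: (x, 0%N); (y, arity_out x + k)%N].
Proof.
move=> trU trW le_s; rewrite /local_sum big_mkcond [RHS]big_mkcond /=.
rewrite !labellings_cons !big_allpairs_dep.
under eq_bigr => oy _ do rewrite big_allpairs_dep.
under [RHS]eq_bigr => ox _ do rewrite big_allpairs_dep.
rewrite [RHS]exchange_big.
apply: eq_big_In => oy /(all_In (oriented_arity y)) /andP[/eqP oy_in _].
apply: eq_big_In => ox /(all_In (oriented_arity x)) /andP[/eqP ox_in /eqP ox_out].
rewrite /labellings !big_seq1 -ox_in -ox_out.
have -> : run s [:: (ox, 0%N); (oy, size (legs_out ox) + k)%N] =
    run s [:: (oy, size (legs_in ox) + k)%N; (ox, 0%N)].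
  by apply/esym/(run_exchange (i := 0)); rewrite add0n ox_in oy_in.
case runu: (run s _) => [s'|] //=; case: ifP => [Ps'|//].
exact (filling_exchange hR trU (trW _ Ps') runu).
Qed.

(** * Zigzags and quarter turns *)

Lemma move_shift i u v : move u v -> move (shift i u) (shift i v).
Proof.
case=> [x y j k|j|j|j|j]; rewrite /shift /= ?addnA ?addnS.
- exact: Exchange.
- exact: ZigzagL.
- exact: ZigzagR.
- exact: TurnL.
- exact: TurnR.
Qed.

Lemma omove_shift i u v : omove u v -> omove (shift i u) (shift i v).
Proof.
have shapeE w : map Defs.shape (shift i w) = shift i (map Defs.shape w).
  by rewrite /shift -!map_comp; apply: eq_map => -[].
by rewrite /omove !shapeE; apply: move_shift.
Qed.

Lemma bracket_fill_move n R (hR : is_MOY n R) s1 s s' U W A u v B :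
    transports [::] (s1 ++ s) U -> transports (s1 ++ s') [::] W ->
    transports s s' (A ++ u ++ B) -> transports s s' (A ++ v ++ B) ->
    omove u v -> turning u = turning v ->
  bracket_crossing n R (U ++ shift (size s1) (A ++ u ++ B) ++ W) =
  bracket_crossing n R (U ++ shift (size s1) (A ++ v ++ B) ++ W).
Proof.
move=> trU trW tru trv uv tuv.
have := transports_fill trU trv trW; have := transports_fill trU tru trW.
have E w : U ++ shift (size s1) (A ++ w ++ B) ++ W =
  (U ++ shift (size s1) A) ++ shift (size s1) w ++ shift (size s1) B ++ W.
  by rewrite !shift_cat !catA.
rewrite !E => cru crv; apply: bracket_crossing_move => //.
  exact: omove_shift.
by rewrite /turning !big_map.
Qed.

Lemma zigzagL_move p i : omove [:: (OCup (~~ p), i.+1); (OCap p, i)] [::].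
Proof. exact: ZigzagL. Qed.

Lemma zigzagR_move p i : omove [:: (OCup p, i); (OCap (~~ p), i.+1)] [::].
Proof. exact: ZigzagR. Qed.

Lemma turning_zigzag b i j :
  turning [:: (OCup (~~ b), i); (OCap b, j)] = turning [::].
Proof. by rewrite /turning !big_cons !big_nil; case: b. Qed.

Ltac transport s :=
  apply/andP; split; [by apply/eqP; case: (s) | by []].

Lemma filter_zigzagL p s :
  [seq o <- labellings [:: (Cup, 1); (Cap, 0)]%N | run (p :: s) o] =
  [:: [:: (OCup (~~ p), 1); (OCap p, 0)]%N].
Proof. by case: p; case: s. Qed.

Lemma filter_zigzagR p s :
  [seq o <- labellings [:: (Cup, 0); (Cap, 1)]%N | run (p :: s) o] =
  [:: [:: (OCup p, 0); (OCap (~~ p), 1)]%N].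
Proof. by case: p; case: s. Qed.

Lemma local_sum_zigzag n R (hR : is_MOY n R) (P : pred (seq bool)) s1 p s U W u :
    transports [::] (s1 ++ p :: s) U ->
    (forall s', P s' -> transports (s1 ++ s') [::] W) ->
    u = [:: (Cup, 1); (Cap, 0)]%N \/ u = [:: (Cup, 0); (Cap, 1)]%N ->
  local_sum n R P (p :: s) U W (size s1) u =
  local_sum n R P (p :: s) U W (size s1) [::].
Proof.
move=> trU trW.
have main (o : oword) : transports (p :: s) (p :: s) o -> omove o [::] ->
    turning o = turning [::] ->
    [seq o <- labellings u | run (p :: s) o] = [:: o] ->
    local_sum n R P (p :: s) U W (size s1) u =
    local_sum n R P (p :: s) U W (size s1) [::].
  move=> tro oo to uE; rewrite (@local_sum_map _ [:: o] id) ?map_id //.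
  rewrite local_sum_nil big_mkcond big_seq1.
  case/andP: (tro) => /eqP-> cro; rewrite [oapp _ _ _]/= filling_crossing //.
  case: ifP => // /trW trW'.
  have := bracket_fill_move (A := [::]) (B := [::]) hR trU trW'.
  by move/(_ o [::]); rewrite /= !cats0; apply=> //; rewrite /transports run_nil eqxx.
case=> uE; rewrite uE in main *.
  apply: (main [:: (OCup (~~ p), 1); (OCap p, 0)]%N) (filter_zigzagL p s).
  - case: p {trU main}; transport s.
  - exact: zigzagL_move.
  - exact: turning_zigzag.
apply: (main [:: (OCup p, 0); (OCap (~~ p), 1)]%N) (filter_zigzagR p s).
- case: p {trU main}; transport s.
- exact: zigzagR_move.
- by have := turning_zigzag (~~ p); rewrite negbK.
Qed.

Definition vertex_tops (a b : bool) : seq (bool * bool) :=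
  [seq cd <- [seq (c, d) | c <- bools, d <- bools] |
     balanced (OVert a b cd.1 cd.2)].

Lemma vertex_tops_balanced a b cd :
  cd \in vertex_tops a b -> balanced (OVert a b cd.1 cd.2).
Proof. by rewrite mem_filter => /andP[]. Qed.

Lemma filter_vert a b s :
  [seq o <- labellings [:: (Vert, 0)]%N | run [:: a, b & s] o] =
  [seq [:: (OVert a b cd.1 cd.2, 0)]%N | cd <- vertex_tops a b].
Proof. by case: a; case: b; case: s. Qed.

(** The orientations inside the bent vertex that correspond to
    [OVert a b cd.1 cd.2]. *)
Definition turn_left (a b : bool) (cd : bool * bool) : oword :=
  [:: (OCup cd.1, 0); (OVert (~~ cd.1) a cd.2 (~~ b), 1); (OCap (~~ b), 2)]%N.

Definition turn_right (a b : bool) (cd : bool * bool) : oword :=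
  [:: (OCup (~~ cd.2), 2); (OVert b (~~ cd.2) (~~ a) cd.1, 1); (OCap a, 0)]%N.

Lemma filter_turnL a b s :
  [seq o <- labellings [:: (Cup, 0); (Vert, 1); (Cap, 2)]%N
     | run [:: a, b & s] o] =
  [seq turn_left a b cd | cd <- vertex_tops a b].
Proof. by case: a; case: b; case: s. Qed.

Lemma filter_turnR a b s :
  [seq o <- labellings [:: (Cup, 2); (Vert, 1); (Cap, 0)]%N
     | run [:: a, b & s] o] =
  [seq turn_right a b cd | cd <-
    [seq cd <- [seq (c, ~~ d) | d <- bools, c <- bools] |
       balanced (OVert a b cd.1 cd.2)]].
Proof. by case: a; case: b; case: s. Qed.

Lemma run_vert a b c d s : balanced (OVert a b c d) ->
  run [:: a, b & s] [:: (OVert a b c d, 0%N)] = Some [:: c, d & s].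
Proof. by case: a b c d => -[] [] [] // _; rewrite /run /= ?take0 ?drop0. Qed.

Lemma run_turn_left a b c d s : balanced (OVert a b c d) ->
  run [:: a, b & s] (turn_left a b (c, d)) = Some [:: c, d & s].
Proof. by case: a b c d => -[] [] [] // _; rewrite /run /= ?take0 ?drop0. Qed.

Lemma run_turn_right a b c d s : balanced (OVert a b c d) ->
  run [:: a, b & s] (turn_right a b (c, d)) = Some [:: c, d & s].
Proof. by case: a b c d => -[] [] [] // _; rewrite /run /= ?take0 ?drop0. Qed.

(** A quarter turn exchanges the vertical and the horizontal smoothing, and it makes
    an incoming lower left end outgoing or conversely; the two effects on the
    coefficients cancel. *)
Lemma filling_turn_alternating n R U W i A B p :
    crossing A -> crossing B ->
    let bc o := bracket_crossing n R (U ++ shift i o ++ W) in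
    bc (A ++ B) = bc [:: (OCap p, 0%N); (OCup p, 0%N)] ->
    bc (A ++ [:: (OCap (~~ p), 1%N); (OCup (~~ p), 1%N)] ++ B) = bc [::] ->
  filling n R U W i (A ++ (OVert (~~ p) p (~~ p) p, 1%N) :: B) =
  filling n R U W i [:: (OVert p (~~ p) p (~~ p), 0%N)].
Proof.
move=> crA crB bc bcAB bcAhB.
have -> : OVert (~~ p) p (~~ p) p = OVert (~~ p) (~~ ~~ p) (~~ p) (~~ ~~ p).
  by rewrite negbK.
rewrite filling_alternating // [RHS](@filling_alternating _ _ _ _ _ [::] [::]) //.
by rewrite -!/(bc _) bcAB bcAhB [in RHS]addrC; case: (p).
Qed.

(** At a crossing-type vertex the bent ends are opposite ends, one incoming and one
    outgoing, so that the new cup and cap have opposite signs and the rotation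
    number does not change. *)
Lemma filling_turn_left n R (hR : is_MOY n R) s1 s U W a b c d :
    transports [::] (s1 ++ [:: a, b & s]) U ->
    transports (s1 ++ [:: c, d & s]) [::] W -> balanced (OVert a b c d) ->
  filling n R U W (size s1) (turn_left a b (c, d)) =
  filling n R U W (size s1) [:: (OVert a b c d, 0%N)].
Proof.
move=> trU trW bal; have mv := bracket_fill_move hR trU trW.
have [alt|nalt] := boolP (alternating (OVert a b c d)); last first.
  have [cE dE] : c = b /\ d = a.
    by case: a b c d nalt bal {trU trW mv} => -[] [] [].
  have cru : crossing (turn_left a b (c, d)).
    by case: a b c d nalt bal {trU trW mv dE cE} => -[] [] [].
  rewrite !filling_crossing //; last by rewrite /crossing /= nalt.
  have := mv [::] (turn_left a b (c, d)) [:: (OVert a b c d, 0%N)] [::].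
  rewrite !cats0; apply.
  - by case: a b c d nalt bal {trU trW mv dE cE cru} => -[] [] [] // _ _;
      transport s.
  - by case: a b c d nalt bal {trU trW mv dE cE cru} => -[] [] [] // _ _;
      transport s.
  - exact: TurnL.
  by rewrite /turning !big_cons !big_nil /= cE sgnN; case: (b).
have [bE cE dE] : [/\ b = ~~ a, c = a & d = ~~ a].
  by case: a b c d alt bal {trU trW mv} => -[] [] [].
move: mv; rewrite {}bE {}cE {}dE {b c d alt bal trU trW} /turn_left /= negbK => mv.
(* The vertical smoothing of the bent vertex leaves a cup and a cap that only
   have to exchange heights, the horizontal one leaves two zigzags. *)
apply: (filling_turn_alternating (A := [:: (OCup a, 0%N)])
  (B := [:: (OCap a, 2%N)])) => //.
  have := mv [::] [:: (OCap a, 0%N); (OCup a, 0%N)]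
     [:: (OCup a, 0%N); (OCap a, 2%N)] [::].
  move=> -> //.
  - by case: (a); transport s.
  - by case: (a); transport s.
  - exact: (@exchange_move (OCup a) (OCap a) 0 0).
  - by rewrite /turning !big_cons.
have := mv [::] [:: (OCup a, 0%N); (OCap (~~ a), 1%N)] [::]
     [:: (OCup (~~ a), 1%N); (OCap a, 2%N)].
move=> /= ->; last 1 first.
- by have := turning_zigzag (~~ a) 0 1; rewrite negbK.
- have := mv [::] [:: (OCup (~~ a), 1%N); (OCap a, 2%N)] [::] [::].
  move=> /= -> //.
  + by case: (a); transport s.
  + by case: (a); transport s.
  + by have := zigzagR_move (~~ a) 1; rewrite negbK.
  + exact: turning_zigzag.
- by case: (a); transport s.
- by case: (a); transport s.
- exact: zigzagR_move.
Qed.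

Lemma filling_turn_right n R (hR : is_MOY n R) s1 s U W a b c d :
    transports [::] (s1 ++ [:: a, b & s]) U ->
    transports (s1 ++ [:: c, d & s]) [::] W -> balanced (OVert a b c d) ->
  filling n R U W (size s1) (turn_right a b (c, d)) =
  filling n R U W (size s1) [:: (OVert a b c d, 0%N)].
Proof.
move=> trU trW bal; have mv := bracket_fill_move hR trU trW.
have [alt|nalt] := boolP (alternating (OVert a b c d)); last first.
  have [cE dE] : c = b /\ d = a.
    by case: a b c d nalt bal {trU trW mv} => -[] [] [].
  have cru : crossing (turn_right a b (c, d)).
    by case: a b c d nalt bal {trU trW mv dE cE} => -[] [] [].
  rewrite !filling_crossing //; last by rewrite /crossing /= nalt.
  have := mv [::] (turn_right a b (c, d)) [:: (OVert a b c d, 0%N)] [::].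
  rewrite !cats0; apply.
  - by case: a b c d nalt bal {trU trW mv dE cE cru} => -[] [] [] // _ _;
      transport s.
  - by case: a b c d nalt bal {trU trW mv dE cE cru} => -[] [] [] // _ _;
      transport s.
  - exact: TurnR.
  by rewrite /turning !big_cons !big_nil /= dE sgnN; case: (a).
have [bE cE dE] : [/\ b = ~~ a, c = a & d = ~~ a].
  by case: a b c d alt bal {trU trW mv} => -[] [] [].
move: mv; rewrite {}bE {}cE {}dE {b c d alt bal trU trW} /turn_right /= negbK => mv.
apply: (filling_turn_alternating (A := [:: (OCup a, 2%N)])
  (B := [:: (OCap a, 0%N)])) => //.
  have := mv [::] [:: (OCup a, 2%N); (OCap a, 0%N)]
     [:: (OCap a, 0%N); (OCup a, 0%N)] [::].
  move=> -> //.
  - by case: (a); transport s.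
  - by case: (a); transport s.
  - exact: (@exchange_move (OCap a) (OCup a) 0 0).
  - by rewrite /turning !big_cons.
have := mv [::] [:: (OCup a, 2%N); (OCap (~~ a), 1%N)] [::]
     [:: (OCup (~~ a), 1%N); (OCap a, 0%N)].
move=> /= ->; last 1 first.
- by have := turning_zigzag (~~ a) 2 1; rewrite negbK.
- have := mv [::] [:: (OCup (~~ a), 1%N); (OCap a, 0%N)] [::] [::].
  move=> /= -> //.
  + by case: (a); transport s.
  + by case: (a); transport s.
  + exact: zigzagL_move.
  + exact: turning_zigzag.
- by case: (a); transport s.
- by case: (a); transport s.
- by have := zigzagL_move (~~ a) 1; rewrite negbK.
Qed.

Lemma local_sum_turn n R (hR : is_MOY n R) (P : pred (seq bool)) s1 a b s U W u :
    transports [::] (s1 ++ [:: a, b & s]) U ->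
    (forall s', P s' -> transports (s1 ++ s') [::] W) ->
    u = [:: (Cup, 0); (Vert, 1); (Cap, 2)]%N \/
    u = [:: (Cup, 2); (Vert, 1); (Cap, 0)]%N ->
  local_sum n R P [:: a, b & s] U W (size s1) u =
  local_sum n R P [:: a, b & s] U W (size s1) [:: (Vert, 0%N)].
Proof.
move=> trU trW uE; rewrite [RHS](local_sum_map _ _ _ _ _ _ (filter_vert a b s)).
case: uE => ->.
  rewrite (local_sum_map _ _ _ _ _ _ (filter_turnL a b s)).
  rewrite big_mkcond [RHS]big_mkcond; apply: eq_big_seq => -[c d].
  move/vertex_tops_balanced => bal; rewrite run_turn_left // run_vert //=.
  case: ifP => // /trW trW'; exact: (filling_turn_left hR trU trW' bal).
rewrite (local_sum_map _ _ _ _ _ _ (filter_turnR a b s)).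
(* On the other side d is the outer index: it is the label of the cup, which
   comes first. *)
rewrite [RHS](perm_big [seq cd <- [seq (c, ~~ d) | d <- bools, c <- bools] |
       balanced (OVert a b cd.1 cd.2)]); last by case: (a); case: (b).
rewrite big_mkcond [RHS]big_mkcond; apply: eq_big_seq => -[c d].
rewrite mem_filter => /andP[bal _]; rewrite run_turn_right // run_vert //=.
case: ifP => // /trW trW'; exact: (filling_turn_right hR trU trW' bal).
Qed.

(** * Isotopy invariance *)

Lemma width_cat m U W : width m (U ++ W) = obind (width^~ W) (width m U).
Proof. by elim: U m => [//|[x i] U IH] m /=; case: ifP. Qed.

Lemma evaluation_move n R (hR : is_MOY n R) U u v W :
    move u v -> is_graph (U ++ u ++ W) ->
  evaluation n R (U ++ u ++ W) = evaluation n R (U ++ v ++ W).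
Proof.
move=> mv; rewrite /is_graph width_cat; case widthU: (width 0 U) => [w|//] /=.
rewrite width_cat; case widthu: (width w u) => [w'|//] _.
rewrite -[RHS]mul1r.
have local i u0 v0 : (i <= w)%N -> u = shift i u0 -> v = shift i v0 ->
    (forall (P : pred (seq bool)) s1 s oU oW, size s = (w - size s1)%N ->
       size s1 = i -> transports [::] (s1 ++ s) oU ->
       (forall s', P s' -> transports (s1 ++ s') [::] oW) ->
       local_sum n R P s oU oW (size s1) u0 =
       local_sum n R P s oU oW (size s1) v0) ->
    evaluation n R (U ++ u ++ W) = 1 * evaluation n R (U ++ v ++ W).
  move=> le_i -> -> local; apply: (@evaluation_local _ _ _ _ _ _ _ _ (w - i)%N).
    by rewrite subnKC.
  by move=> P s1 s oU oW sz1; rewrite mul1r -{1 2 3}sz1 => *; apply: local.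
case: mv local widthu => [x y i k|i|i|i|i] local /=; case: ifP => // le1;
  case: ifP => // le2; [| | | case: ifP => // le3 | case: ifP => // le3] => _.
- apply: (local i [:: (y, arity_in x + k); (x, 0)]%N
                  [:: (x, 0); (y, arity_out x + k)]%N); first by lia.
  + by rewrite /shift /= !addnA addn0.
  + by rewrite /shift /= !addnA addn0.
  move=> P s1 s oU oW sz sz1 trU trW.
  by apply: local_sum_exchange => //; rewrite sz; lia.
- apply: (local i [:: (Cup, 1); (Cap, 0)]%N [::]); first by lia.
  + by rewrite /shift /= addn0 addn1.
  + by [].
  move=> P s1 [|p s] oU oW /= sz sz1 trU trW; first by lia.
  by apply: local_sum_zigzag => //; left.
- apply: (local i [:: (Cup, 0); (Cap, 1)]%N [::]); first by lia.
  + by rewrite /shift /= addn0 addn1.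
  + by [].
  move=> P s1 [|p s] oU oW /= sz sz1 trU trW; first by lia.
  by apply: local_sum_zigzag => //; right.
- apply: (local i [:: (Cup, 0); (Vert, 1); (Cap, 2)]%N [:: (Vert, 0%N)]).
  + by lia.
  + by rewrite /shift /= addn0 addn1 addn2.
  + by rewrite /shift /= addn0.
  move=> P s1 [|a [|b s]] oU oW /= sz sz1 trU trW; [by lia | by lia |].
  by apply: local_sum_turn => //; left.
- apply: (local i [:: (Cup, 2); (Vert, 1); (Cap, 0)]%N [:: (Vert, 0%N)]).
  + by lia.
  + by rewrite /shift /= addn0 addn1 addn2.
  + by rewrite /shift /= addn0.
  move=> P s1 [|a [|b s]] oU oW /= sz sz1 trU trW; [by lia | by lia |].
  by apply: local_sum_turn => //; right.
Qed.

Lemma evaluation_isotopic n R (hR : is_MOY n R) G H :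
  isotopic G H -> evaluation n R G = evaluation n R H.
Proof.
elim=> {G H} [U u v W mv gu _|G|G H _ ->|G H K _ -> _ ->] //.
exact: evaluation_move mv gu.
Qed.

(** * Removal of the loop *)

Lemma q_neq0 : q != 0.
Proof. by rewrite /q tofrac_eq0 polyX_eq0. Qed.

Lemma q2_neq1 : q ^+ 2 != 1.
Proof.
rewrite /q -tofracXn -tofrac1 tofrac_eq -['X^2 in X in X == _]expr1.
apply/eqP => /(congr1 (fun p : {poly int} => size p)).
by rewrite expr1 size_polyXn size_poly1.
Qed.

(** The scalar identity behind the theorem. For [p = true] it reads
    [q^(n-1) [n-1] + q * q^(1-n) [n] + q^-1 = [2n-2] + [2]], and after
    multiplication by [q - q^-1] the left-hand side telescopes. The other case
    is its image under [q -> q^-1]. *)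
Lemma loop_coefficient_field (K : fieldType) (x : K) (n : nat) (p : bool) :
    x != 0 -> x ^+ 2 != 1 ->
  let quantum (m : int) := (x ^ m - x ^ (- m)) / (x - x^-1) in
  (x ^ (1 - n%:Z)) ^ sgn p * quantum (n%:Z - 1) +
  ((if p then x else x^-1) * ((x ^ (1 - n%:Z)) ^ sgn (~~ p) * quantum n%:Z) +
   (if p then x^-1 else x)) =
  quantum (2 * n%:Z - 2) + quantum 2.
Proof.
move=> x0 x1 quantum; rewrite /quantum.
have x1' : x * x - 1 != 0 by rewrite -expr2 subr_eq0.
set A := x ^ n%:Z; have A0 : A != 0 by rewrite expfz_neq0.
have xN m : x ^ (- m) = (x ^ m)^-1 by rewrite invr_expz.
have E1 : x ^ (n%:Z - 1) = A / x by rewrite expfzDr.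
have E2 : x ^ (1 - n%:Z) = x / A by rewrite -opprB xN E1 invf_div.
have E3 : x ^ (2 * n%:Z - 2) = (A / x) ^+ 2.
  have -> : 2 * n%:Z - 2 = (n%:Z - 1) + (n%:Z - 1) by ring.
  by rewrite expfzDr // E1.
rewrite !xN E1 E2 E3 -/A -[x ^ 2]/(x ^+ 2).
by case: p; rewrite /= ?expr1z ?exprN1 ?invf_div; field; rewrite x0 A0 x1'.
Qed.

Lemma loop_coefficient (n : nat) (p : bool) :
  (q ^ (1 - n%:Z)) ^ sgn p * qint (n%:Z - 1) +
  ((if p then q else q^-1) * ((q ^ (1 - n%:Z)) ^ sgn (~~ p) * qint n%:Z) +
   (if p then q^-1 else q)) =
  qint (2 * n%:Z - 2) + qint 2.
Proof. exact (loop_coefficient_field n p q_neq0 q2_neq1). Qed.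

(** Removing a loop or a circle of direction [b] multiplies [R] by a scalar and
    changes the rotation number by [sgn b]. *)
Lemma bracket_crossing_scale n R G H (c : LF) b :
    is_crossing_graph G -> is_crossing_graph H ->
    R G = c * R H -> turning G = sgn b *+ 2 + turning H ->
  bracket_crossing n R G =
  (q ^ (1 - n%:Z)) ^ sgn b * c * bracket_crossing n R H.
Proof.
move=> crG crH RE tE; rewrite /bracket_crossing RE.
have -> : rotation_number G = sgn b + rotation_number H.
  apply: (@pmulrnI _ 2 isT).
  by rewrite mulrnDl !rotation_number_turning // tE.
have t_neq0 : q ^ (1 - n%:Z) != 0 by rewrite expfz_neq0 // q_neq0.
rewrite (expfzDr _ _ t_neq0) -2!mulrA.
by congr (_ * _); apply: mulrCA.
Qed.

Definition loop_label (p b : bool) : oword :=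
  [:: (OCup b, 1); (OVert p b p b, 0); (OCap b, 1)]%N.

Lemma filter_loop p s :
  [seq o <- labellings [:: (Cup, 1); (Vert, 0); (Cap, 1)]%N | run (p :: s) o] =
  [seq loop_label p b | b <- bools].
Proof. by case: p; case: s. Qed.

Lemma run_loop_label p b s :
  run (p :: s) (loop_label p b) = Some (p :: s).
Proof. by case: p b s => -[] []. Qed.

Lemma run_circle p b s :
  run (p :: s) [:: (OCup b, 1%N); (OCap b, 1%N)] = Some (p :: s).
Proof. by case: b s => -[]. Qed.

Lemma sum_bools (V : nmodType) (f : bool -> V) p :
  \sum_(b <- bools) f b = f p + f (~~ p).
Proof. by rewrite big_cons big_seq1; case: p => //; rewrite addrC. Qed.

(** If the left end of the cup of the loop has the direction [p] of the strand, the
    vertex is crossing-type and the loop relation applies; otherwise it is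
    alternating, and its smoothings give a circle next to the strand or the
    strand alone. *)
Lemma local_sum_loop n R (hR : is_MOY n R) (P : pred (seq bool)) s1 p s U W :
    transports [::] (s1 ++ p :: s) U ->
    (forall s', P s' -> transports (s1 ++ s') [::] W) ->
  local_sum n R P (p :: s) U W (size s1) [:: (Cup, 1); (Vert, 0); (Cap, 1)]%N =
  (qint (2 * n%:Z - 2) + qint 2) *
  local_sum n R P (p :: s) U W (size s1) [::].
Proof.
move=> trU trW; rewrite (local_sum_map _ _ _ _ _ _ (filter_loop p s)) local_sum_nil.
rewrite big_mkcond; under eq_bigr => b _ do rewrite run_loop_label /=.
case: ifP => [/trW trW'|_]; last by rewrite mulr0 big1.
have crUW : is_crossing_graph (U ++ W) by apply: transports_cat trU trW'.
rewrite (sum_bools _ p).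
have mv := bracket_fill_move hR trU trW'.
have -> : filling n R U W (size s1) (loop_label p p) =
    (q ^ (1 - n%:Z)) ^ sgn p * qint (n%:Z - 1) * bracket_crossing n R (U ++ W).
  rewrite filling_crossing; last by case: (p).
  have cr : is_crossing_graph (U ++ shift (size s1) (loop_label p p) ++ W).
    apply: transports_fill trU _ trW'.
    by rewrite /transports run_loop_label eqxx; case: (p).
  apply: bracket_crossing_scale => //.
    have := MOY_loop_right hR (b := p) (i := size s1) (U := U) (W := W).
    rewrite /= !big_seq1 /= mul1r; move: cr; rewrite /loop_label /shift /= addn0 addn1.
    by move=> -> /=; rewrite crUW; apply.
  rewrite !turning_cat addrCA; congr (_ + _).
  by rewrite /turning !big_cons big_nil /= add0r addr0 mulr2n.
(* Alternating vertex: one smoothing splits off a circle, the other one leaves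
   two zigzags. *)
rewrite (@filling_alternating _ _ _ _ _ [:: (OCup (~~ p), 1%N)] [:: (OCap (~~ p), 1%N)]) //=.
have -> : bracket_crossing n R
    (U ++ shift (size s1) [:: (OCup (~~ p), 1%N); (OCap (~~ p), 1%N)] ++ W) =
    (q ^ (1 - n%:Z)) ^ sgn (~~ p) * qint n%:Z * bracket_crossing n R (U ++ W).
  set o := [:: _; _].
  have cr : is_crossing_graph (U ++ shift (size s1) o ++ W).
    apply: transports_fill trU _ trW'.
    by rewrite /transports run_circle eqxx.
  apply: bracket_crossing_scale => //.
    have := MOY_circle hR (b := ~~ p) (i := (size s1).+1) (U := U) (W := W).
    rewrite /= !big_seq1 /= mul1r; move: cr; rewrite /o /shift /= addn1.
    by move=> -> /=; rewrite crUW; apply.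
  rewrite !turning_cat addrCA; congr (_ + _).
  by rewrite /turning !big_cons big_nil /= addr0 mulr2n.
have -> : bracket_crossing n R
    (U ++ shift (size s1) [:: (OCup (~~ p), 1%N); (OCap p, 0%N);
                              (OCup p, 0%N); (OCap (~~ p), 1%N)] ++ W) =
    bracket_crossing n R (U ++ W).
  have := mv [::] [:: (OCup (~~ p), 1%N); (OCap p, 0%N)] [::]
     [:: (OCup p, 0%N); (OCap (~~ p), 1%N)].
  move=> /= ->; last 1 first.
  - exact: turning_zigzag.
  - have := mv [::] [:: (OCup p, 0%N); (OCap (~~ p), 1%N)] [::] [::].
    move=> /= -> //.
    + by case: (p); transport s.
    + by case: (p); transport s.
    + exact: zigzagR_move.
    + by have := turning_zigzag (~~ p) 0 1; rewrite negbK.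
  - by case: (p); transport s.
  - by case: (p); transport s.
  - exact: zigzagL_move.
by rewrite -(loop_coefficient n p) !mulrDl !mulrA.
Qed.

Theorem proposition2 (n : nat) (hn : (2 <= n)%N)
    (R : oword -> LF) (hR : is_MOY n R)
    (G G' : word) (hG : is_graph G) (hG' : is_graph G')
    (hloop : loop_removal G G') :
  evaluation n R G =
  (qint (2 * n%:Z - 2) + qint 2) * evaluation n R G'.
Proof.
case: hloop => U [W [i [gH gH' isoG isoG']]].
rewrite (evaluation_isotopic hR isoG) (evaluation_isotopic hR isoG').
move: gH; rewrite /is_graph width_cat; case widthU: (width 0 U) => [w|//] /=.
case: ifP => // le_w _.
have E : U ++ [:: (Cup, i.+1), (Vert, i), (Cap, i.+1) & W] =
    U ++ shift i [:: (Cup, 1); (Vert, 0); (Cap, 1)]%N ++ W.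
  by rewrite /shift /= addn0 addn1.
rewrite E; apply: (@evaluation_local n R _ U W _ [::] i (w - i)).
  by rewrite subnKC //; lia.
move=> P s1 [|p s] oU oW sz1 /= sz trU trW; first by lia.
by rewrite -sz1; apply: local_sum_loop.
Qed.
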